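(* Let $E\subset\mathbb R$ be a central Cantor set with $\min E=0$ and let $(x_n)_{n\in\mathbb N}$ be the unique fast convergent sequence such that $E=E(x_n)$. Then $E$ is uniquely achievable if and only if $x_n\ne 2x_{n+1}$ for all $n\in\mathbb N$.
   Context: All sequences are infinite, summable sequences of positive real numbers arranged in non-increasing order, indexed by $\mathbb N=\{1,2,\dots\}$. The achievement set of $(x_n)$ is $E(x_n)=\{\sum_{n\in A}x_n : A\subset\mathbb N\}$ (the empty sum is $0$). A sequence $(x_n)$ is fast convergent if $x_n>\sum_{k>n}x_k$ for all $n$. A central Cantor set with left endpoint $0$ is a set $\bigcap_n I_n$ obtained as follows. Start with $I_0=[0,y_0]$, $y_0>0$. Inductively, $I_{n-1}$ is a disjoint union of $2^{n-1}$ closed intervals of common length $y_{n-1}$. From each of them remove the concentric (middle) open interval of length $g_n$, where $0<g_n<y_{n-1}$ depends only on $n$; the result is $I_n$, a union of $2^n$ closed intervals of common length $y_n=(y_{n-1}-g_n)/2$. If $(y_n,x_n)$ denotes the open interval removed in step $n$ from the leftmost component of $I_{n-1}$, then $(x_n)$ is fast convergent and the central Cantor set equals $E(x_n)$. It is the unique fast convergent representation of this set. Conversely, $E(x_n)$ is a central Cantor set for every fast convergent $(x_n)$. An achievement set $E=E(x_n)$ is uniquely achievable if there is no summable, positive, non-increasing sequence $(y_n)\neq(x_n)$ with $E(y_n)=E(x_n)$. *)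

(* Defs.v *)
(* A sequence is indexed from 0: [x n] stands for the
   term of index n+1 of a sequence indexed by {1, 2, ...}. *)
From mathcomp Require Import all_boot all_order all_algebra.
From mathcomp Require Import all_classical all_reals all_analysis.

Set Implicit Arguments.
Unset Strict Implicit.
Unset Printing Implicit Defensive.

Import Order.TTheory GRing.Theory Num.Theory.
Import numFieldNormedType.Exports.

Local Open Scope classical_set_scope.
Local Open Scope ring_scope.

Definition admissible (R : realType) (x : R^nat) : Prop :=
  [/\ forall n, 0 < x n, nonincreasing_seq x & cvgn (series x)].

Definition achievement_set (R : realType) (x : R^nat) : set R :=
  [set limn (fun n => \sum_(0 <= k < n | k \in A) x k) | A in [set: set nat]].

Definition fast_convergent (R : realType) (x : R^nat) : Prop :=
  forall n, limn (fun m => \sum_(n.+1 <= k < m) x k) < x n.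

Section CentralCantor.
Variables (R : realType) (a y0 : R) (g : R^nat).

(* [g n] is the length of the gaps removed in passing from stage [n] to
   stage [n.+1], [cantor_len n] the common length of the components of stage
   [n], and [cantor_left n] the set of their left endpoints. *)
Fixpoint cantor_len (n : nat) : R :=
  if n is m.+1 then (cantor_len m - g m) / 2 else y0.

Fixpoint cantor_left (n : nat) : set R :=
  if n is m.+1 then
    cantor_left m `|`
    [set l + (cantor_len m + g m) / 2 | l in cantor_left m]
  else [set a].

Fixpoint cantor_stage (n : nat) : set R :=
  if n is m.+1 then
    cantor_stage m `\`
    \bigcup_(l in cantor_left m)
      [set` `]l + (cantor_len m - g m) / 2, l + (cantor_len m + g m) / 2[ ]
  else [set` `[a, a + y0] ].

End CentralCantor.

Definition central_cantor_set (R : realType) (E : set R) : Prop :=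
  exists (a y0 : R) (g : R^nat),
    [/\ 0 < y0,
        forall n, 0 < g n < cantor_len y0 g n
      & E = \bigcap_n cantor_stage a y0 g n].

Definition uniquely_achievable (R : realType) (E : set R) : Prop :=
  exists x : R^nat,
    [/\ admissible x, E = achievement_set x
      & ~ exists y : R^nat,
          [/\ admissible y, y <> x & achievement_set y = achievement_set x]].

(* Main.v *)
(* If [x n = 2 * x n.+1], the pair [x n, x n.+1] can be replaced by three copies
   of [x n.+1] without changing the set of subsums.

   Conversely, put [gap n = x n - tail x n.+1] and call [p] dominant if
   [gap j < gap p] for all [j > p]; dominant indices are unbounded.  Let [y] have
   the same subsums [E].  At a dominant [p] the terms of [y] not exceeding
   [tail x p.+1] sum exactly to [tail x p.+1], since their subsums leave no gap
   as long as [gap p] and hence cannot jump over it.  From there one goes back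
   down to index 0: if a tail of [y] has the sum [tail x n.+1] and consists of
   all its terms up to that size, the preceding term must be [x n], and any
   further term [w <= tail x n] would satisfy
   [w + (E `&` [0, tail x n]) `<=` E], which is impossible when no ratio
   [x k / x k.+1] is 2. *)
Require Import Defs.
From mathcomp Require Import all_boot all_order all_algebra zify lra.
From mathcomp Require Import all_classical all_reals all_analysis.
Import Order.TTheory GRing.Theory Num.Theory.
Import numFieldNormedType.Exports.
Local Open Scope classical_set_scope.
Local Open Scope ring_scope.

Set Implicit Arguments.
Unset Strict Implicit.

(** * Subsums and tails of an admissible sequence *)

Definition subsum (R : realType) (x : R^nat) (A : set nat) : R :=
  limn (fun n => \sum_(0 <= k < n | k \in A) x k).

(** Encoded as a subsum, so that comparing tails and peeling off a term are instances of the lemmas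
    on [subsum]. *)
Definition tail (R : realType) (x : R^nat) (n : nat) : R :=
  subsum x [set k | (n <= k)%N].

Section Subsums.
Context (R : realType) (x : R^nat) (admx : admissible x).

Let x_gt0 n : 0 < x n. Proof. by case: admx. Qed.
Let x_ge0 n : 0 <= x n. Proof. exact/ltW. Qed.

Lemma admissible_le m n : (m <= n)%N -> x n <= x m.
Proof. by case: admx => _ + _; apply. Qed.

Let restr (A : set nat) : R^nat := fun k => if k \in A then x k else 0.

Let subsumE A : subsum x A = limn (series (restr A)).
Proof.
by congr (limn _); apply/funext => n; rewrite /series /= big_mkcond.
Qed.

Let is_cvg_restr A : cvgn (series (restr A)).
Proof.
case: admx => _ _; apply: series_le_cvg => // n; rewrite /restr; by case: ifP.
Qed.

Lemma is_cvg_subsum (A : set nat) : cvgn (fun n => \sum_(0 <= k < n | k \in A) x k).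
Proof.
rewrite (_ : (fun _ => _) = series (restr A))//.
by apply/funext => n; rewrite /series /= big_mkcond.
Qed.

Lemma subsum_le (A B : set nat) : A `<=` B -> subsum x A <= subsum x B.
Proof.
move=> AB; rewrite !subsumE; apply: lim_series_le => // n; rewrite /restr.
case: ifPn => [/set_mem/AB/mem_set ->//|_]; by case: ifP.
Qed.

Lemma subsum0 : subsum x set0 = 0.
Proof.
rewrite subsumE (_ : series _ = fun=> 0); first exact: lim_cst.
by apply/funext => n; rewrite /series /= big1 // => i _; rewrite /restr in_set0.
Qed.

Lemma subsum_ge0 A : 0 <= subsum x A.
Proof. by rewrite -subsum0; apply: subsum_le. Qed.

Lemma subsumU1 n A : ~ A n -> subsum x (n |` A) = x n + subsum x A.
Proof.
move=> An; rewrite !subsumE.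
have cn : series (fun k => if k == n then x n else 0) @ \oo --> x n.
  apply: cvg_near_cst; exists n.+1 => // m /= nm.
  by rewrite /series /= -big_mkcond big_nat1_eq nm.
rewrite (_ : restr _ = (fun k => if k == n then x n else 0) + restr A).
  by rewrite lim_seriesD// ?(cvg_lim _ cn)//; apply: cvgP cn.
apply/funext => k; rewrite /restr !fctE.
have [->|kn] := eqVneq k n.
  by rewrite mem_set ?memNset ?addr0//; left.
by rewrite add0r; congr (if _ then _ else _); rewrite in_setU in_set1 (negbTE kn).
Qed.

Lemma subsum1 n : subsum x [set n] = x n.
Proof. by rewrite -[X in subsum _ X]setU0 subsumU1// subsum0 addr0. Qed.

Lemma subsumD1 n A : A n -> subsum x A = x n + subsum x (A `\ n).
Proof. by move=> An; rewrite -subsumU1 ?setD1K// => -[_]; apply. Qed.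

Lemma subsum_ge n A : A n -> x n <= subsum x A.
Proof. by move=> An; rewrite -[leLHS]subsum1; apply: subsum_le => _ ->. Qed.

Lemma tailS n : tail x n = x n + tail x n.+1.
Proof.
rewrite /tail (@subsumD1 n) /=; last exact: leqnn.
congr (_ + subsum x _); apply/seteqP; split=> k /=.
  by case=> nk /eqP kn; rewrite ltn_neqAle eq_sym kn.
by move=> nk; split; [exact: ltnW|move=> kn; rewrite kn ltnn in nk].
Qed.

Lemma tail_gt0 n : 0 < tail x n.
Proof. by rewrite tailS ltr_pwDl// subsum_ge0. Qed.

Lemma le_tail m n : (m <= n)%N -> tail x n <= tail x m.
Proof. by move=> mn; apply: subsum_le => k /=; apply: leq_trans. Qed.

Lemma tailE n : tail x n = limn (series x) - series x n.
Proof.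
elim: n => [|n IH].
  rewrite /series /= big_geq// subr0; congr (limn _).
  by apply/funext => m; apply: eq_bigl => k; rewrite mem_set.
by apply: (@addrI _ (x n)); rewrite -tailS IH seriesSr; lra.
Qed.

Lemma cvg_tail : tail x @ \oo --> 0.
Proof.
rewrite (_ : tail x = fun n => limn (series x) - series x n); last first.
  by apply/funext => n; exact: tailE.
rewrite -[X in _ --> X](subrr (limn (series x))).
by apply: cvgB; [exact: cvg_cst|case: admx].
Qed.

Lemma fast_convergentE : fast_convergent x -> forall n, tail x n.+1 < x n.
Proof.
move=> + n => /(_ n).
suff -> : tail x n.+1 = limn (fun m => \sum_(n.+1 <= k < m) x k) by [].
congr (limn _); apply/funext => m.
rewrite [RHS](big_nat_widenl _ 0)//; apply: eq_bigl => k.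
by apply/idP/idP => [/set_mem|/= nk]//; apply/mem_set.
Qed.

Lemma achievement_setP e :
  achievement_set x e <-> exists A, e = subsum x A.
Proof. by split=> [[A _ <-]|[A ->]]; exists A. Qed.

Lemma achievement_tail n : achievement_set x (tail x n).
Proof. by apply/achievement_setP; eexists. Qed.

Lemma achievement_term n : achievement_set x (x n).
Proof. by apply/achievement_setP; exists [set n]; rewrite subsum1. Qed.

Lemma subsum_gt_tail n A : tail x n < subsum x A -> exists2 k, (k < n)%N & A k.
Proof.
move=> nA; apply: contrapT => /forall2NP kA.
move: nA; rewrite ltNge => /negP; apply; apply: subsum_le => k Ak /=.
by rewrite leqNgt; apply/negP => kn; case: (kA k).
Qed.

Lemma subsum_lt_term n A : subsum x A < x n -> A `<=` [set k | (n < k)%N].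
Proof.
move=> An k Ak /=; rewrite ltnNge; apply/negP => /admissible_le kn.
by have := lt_le_trans An (le_trans kn (subsum_ge Ak)); rewrite ltxx.
Qed.

Lemma term_lt_eventually (c : R) : 0 < c -> exists n, x n < c.
Proof.
move=> c0; case: admx => _ _ /cvg_series_cvg_0 x0.
by have [n _ /(_ n (leqnn n))] := cvgr_lt _ x0 _ c0; exists n.
Qed.

Lemma tail_lt_eventually (c : R) : 0 < c -> exists n, tail x n < c.
Proof.
move=> c0; have [n _ /(_ n (leqnn n))] := cvgr_lt _ cvg_tail _ c0.
by exists n.
Qed.

(** Greedy choice: take [N] if [c] exceeds [x N], skip it if the later terms can still reach [c]. If
    neither applies, [c] lies above the whole later tail, by less than [g]. *)
Lemma subsum_dense (g : R) N c :
  0 < g -> (forall i, (N <= i)%N -> x i < tail x i.+1 + g) ->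
  0 < c <= tail x N ->
  exists A, [/\ A `<=` [set k | (N <= k)%N], subsum x A < c
               & c < subsum x A + g].
Proof.
move=> g0; have [M Mg] := tail_lt_eventually g0.
(* Induction on the distance to [M]: its tail is below [g], so there the empty subsum is close
   enough. *)
have [d] : exists d, (M <= N + d)%N by exists M; exact: leq_addl.
elim: d N c => [|d IH] N c MNd xg /andP[c0 cN].
  exists set0; rewrite subsum0; split=> //; rewrite add0r.
  rewrite addn0 in MNd.
  exact: le_lt_trans (le_trans cN (le_tail MNd)) Mg.
have {}IH c' : 0 < c' <= tail x N.+1 ->
    exists A, [/\ A `<=` [set k | (N < k)%N], subsum x A < c'
               & c' < subsum x A + g].
  by apply: IH => [|i /ltnW]; [rewrite addSnnS|exact: xg].
have [cx|xc] := leP c (x N); last first.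
  have [|A [AN Ac cA]] := IH (c - x N).
    by rewrite subr_gt0 xc lerBlDl -tailS.
  exists (N |` A); rewrite subsumU1; last by move=> /AN; rewrite /= ltnn.
  split; [|lra|lra].
  by move=> k [->|/AN/ltnW]//=.
have [ct|tc] := leP c (tail x N.+1).
  have [|A [AN Ac cA]] := IH c; first by rewrite c0.
  by exists A; split=> // k /AN /ltnW.
exists [set k | (N < k)%N]; split=> //; first by move=> k /ltnW.
by apply: le_lt_trans cx _; exact: xg.
Qed.

End Subsums.

(** * Gaps and translates in the fast convergent case *)

Section FastConvergent.
Context (R : realType) (x : R^nat) (admx : admissible x).
Context (fastx : forall n, tail x n.+1 < x n).

Let E := achievement_set x.
Let gap n := x n - tail x n.+1.

Lemma achievement_gap n e : E e -> tail x n.+1 < e -> x n <= e.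
Proof.
move=> /achievement_setP[A ->] /(subsum_gt_tail admx)[k].
rewrite ltnS => /(admissible_le admx) kn Ak.
exact: le_trans kn (subsum_ge admx Ak).
Qed.

Lemma achievement_le_tail n e : E e -> e < x n -> e <= tail x n.+1.
Proof.
by move=> Ee; apply: contraTT; rewrite -leNgt -ltNge; exact: achievement_gap.
Qed.

Lemma achievement_add n e : E e -> e <= tail x n.+1 -> E (x n + e).
Proof.
move=> /achievement_setP[A ->] An; apply/achievement_setP.
exists (n |` A); rewrite (subsumU1 admx)// => /(subsum_ge admx).
by move=> /le_trans/(_ An); rewrite leNgt fastx.
Qed.

(** A subsum above [tail x n.+1] uses an index at most [n]. A smaller index is excluded because its
    term exceeds [tail x n], so [n] itself can be removed. *)
Lemma achievement_sub n e : E e -> x n <= e <= tail x n -> E (e - x n).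
Proof.
move=> /achievement_setP[A ->] /andP[nA An]; apply/achievement_setP.
have [k] := subsum_gt_tail admx (lt_le_trans (fastx n) nA).
rewrite ltnS leq_eqVlt => /predU1P[->{k} An'|kn Ak].
  by exists (A `\ n); rewrite (subsumD1 admx An') addrC addKr.
have := le_trans (subsum_ge admx Ak) (le_trans An (le_tail admx kn)).
by rewrite leNgt fastx.
Qed.

(** The index [k] is the least one with [tail x k.+1 < w]. *)
Lemma achievement_leading m w : 0 < w <= tail x m ->
  E w -> exists k, [/\ (m <= k)%N, x k <= w & w <= tail x k].
Proof.
move=> /andP[w0 wm] Ew.
have ex : exists n, tail x n.+1 < w.
  have [n nw] := tail_lt_eventually admx w0.
  by exists n; apply: le_lt_trans nw; exact: le_tail.
case: (ex_minnP ex) => k kw kmin; exists k; split.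
- rewrite leqNgt; apply/negP => km.
  by have := lt_le_trans kw (le_trans wm (le_tail admx km)); rewrite ltxx.
- exact: achievement_gap kw.
- case: k kw kmin => [|k] kw kmin.
    by apply: le_trans wm _; exact: le_tail.
  by rewrite leNgt; apply/negP => /kmin; rewrite ltnn.
Qed.

(** Gaps are bounded by the terms and so tend to 0; [p] is the last index whose gap is at least
    [gap m]. *)
Lemma dominant_gap m :
  exists p, (m <= p)%N /\ forall j, (p < j)%N -> gap j < gap p.
Proof.
have gm : 0 < gap m by rewrite subr_gt0.
have [n nm] := term_lt_eventually admx gm.
have ub j : gap m <= gap j -> (j <= n)%N.
  rewrite leNgt => mj; rewrite leqNgt; apply: contraNN mj => /ltnW nj.
  apply: le_lt_trans nm; apply: le_trans (admissible_le admx nj).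
  by rewrite lerBlDr lerDl ltW// tail_gt0.
have [p mp pmax] := ex_maxnP (ex_intro _ m (lexx (gap m))) ub.
exists p; split=> [|j]; first exact: pmax.
by apply: contraTT; rewrite -leNgt -leqNgt => /(le_trans mp)/pmax.
Qed.

Lemma dominant_gap_dense p c : (forall j, (p < j)%N -> gap j < gap p) ->
  0 < c <= tail x p.+1 -> exists2 q, E q & q < c < q + gap p.
Proof.
move=> dp cp.
have [||A [_ Ac cA]] := @subsum_dense _ _ admx (gap p) p.+1 c _ _ cp.
- by rewrite subr_gt0.
- by move=> i /dp; rewrite /gap; lra.
- by exists (subsum x A); [apply/achievement_setP; exists A|rewrite Ac].
Qed.

(** The translate would start below the gap between [tail x p.+1] and [x p] and end beyond it, with
    steps too short to jump over it. *)
Lemma no_translate_dominant p w : (forall j, (p < j)%N -> gap j < gap p) ->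
  0 < w <= tail x p.+1 ->
  ~ (forall e, E e -> e <= tail x p.+1 -> E (w + e)).
Proof.
move=> dp /andP[w0 wp] wE.
have xw : x p <= w + tail x p.+1.
  by apply: achievement_gap (wE _ (achievement_tail x _) _) _ => //; rewrite ltrDr.
(* The target [x p - w] makes [w + q] fall strictly inside that gap. *)
have [|q Eq /andP[qx xq]] := @dominant_gap_dense p (x p - w) dp.
  by rewrite subr_gt0 (le_lt_trans wp (fastx p)) lerBlDl.
rewrite /gap in xq; have qp : q <= tail x p.+1 by lra.
have : x p <= w + q by apply: achievement_gap (wE _ Eq qp) _; lra.
by lra.
Qed.

(* If [w] has leading term [x k.+1], then adding [x k.+1] to [w] lands in the
   block starting at [x k], and [w + x k.+1 - x k] again translates a tail into
   [E]. This descent stops before reaching a dominant gap. *)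
Lemma no_translate m w : (forall n, x n <> 2 * x n.+1) ->
  E w -> 0 < w <= tail x m.+1 ->
  ~ (forall e, E e -> e <= tail x m.+1 -> E (w + e)).
Proof.
move=> x2; have [p [mp dp]] := dominant_gap m.
have [d pmd] : exists d, (p <= m + d)%N by exists p; exact: leq_addl.
elim: d m w mp pmd => [|d IH] m w mp pmd Ew wm wE;
  have := le_tail admx (mp : (m.+1 <= p.+1)%N) => pm;
  (have [wp|pw] := leP w (tail x p.+1);
    first by apply: (no_translate_dominant dp (w := w)) => [|e Ee ep];
      [case/andP: wm => ->|apply: wE => //; exact: le_trans ep pm]).
  have pm' : p = m by apply/eqP; rewrite eqn_leq mp andbT -[m]addn0.
  by case/andP: wm => _; rewrite -pm' leNgt pw.
have [[|k] [] // mk kw wk] := achievement_leading wm Ew.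
have kp : (k < p)%N.
  rewrite ltnNge; apply/negP => pk.
  have := le_trans wk (le_tail admx (pk : (p.+1 <= k.+1)%N)).
  by rewrite leNgt pw.
have [fk fk1] := (fastx k, fastx k.+1).
have [tk tk1] := (tailS admx k, tailS admx k.+1).
have t2 := tail_gt0 admx k.+2.
have km : tail x k.+1 <= tail x m.+1 by exact: le_tail.
have Ewx : E (w + x k.+1) by apply: wE; [exact: achievement_term|lra].
(* Since [w] is at least [x k.+1], the sum is at least twice [x k.+1], which exceeds
   [tail x k.+1]. *)
have xw : x k <= w + x k.+1 by apply: achievement_gap Ewx _; lra.
have Ev : E (w + x k.+1 - x k) by apply: achievement_sub => //; lra.
have vk : w + x k.+1 - x k <= tail x k.+2.
  by apply: achievement_le_tail => //; lra.
(* If [w = x k - x k.+1], translating [tail x k.+2] stays below [x k] and forces [w = x k.+1], hence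
   the excluded ratio 2. *)
have [v0|v0] := eqVneq (w + x k.+1 - x k) 0.
  have Et : E (w + tail x k.+2) by apply: wE; [exact: achievement_tail|lra].
  have : w + tail x k.+2 <= tail x k.+1 by apply: achievement_le_tail => //; lra.
  by move=> ?; apply: (x2 k); lra.
apply: (IH k.+1 _ kp _ Ev) => [||e Ee ek].
- by apply: leq_trans pmd _; rewrite addnS -addSn leq_add2r.
- by rewrite vk andbT lt_def v0 subr_ge0.
have Exe := achievement_add Ee ek.
have Ewe : E (w + (x k.+1 + e)) by apply: wE Exe _; lra.
have e0 : 0 <= e by move/achievement_setP: Ee => [A ->]; exact: subsum_ge0.
have -> : w + x k.+1 - x k + e = w + (x k.+1 + e) - x k by lra.
by apply: achievement_sub => //; lra.
Qed.

(** * A second sequence with the same achievement set *)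

Section SameSet.
Context (y : R^nat) (admy : admissible y).
Context (Exy : achievement_set y = achievement_set x).

Let subsumy e : E e -> exists A, e = subsum y A.
Proof. by rewrite /E -Exy => /achievement_setP. Qed.

(** Both totals are the maximum of [E]. *)
Let tail0 : tail y 0 = tail x 0.
Proof.
apply/eqP; rewrite eq_le; apply/andP; split.
  have : E (tail y 0) by rewrite /E -Exy; exact: achievement_tail.
  by move=> /achievement_setP[A ->]; exact: subsum_le.
by have [A ->] := subsumy (achievement_tail x 0); exact: subsum_le.
Qed.

(** Terms of [y] from [N] on are at most their sum [tail x n], so [N] counts exactly the terms of
    [y] above that value. *)
Let sync n N := tail y N = tail x n /\ forall k, (k < N)%N -> tail x n < y k.

Lemma sync_dominant p : (forall j, (p < j)%N -> gap j < gap p) ->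
  exists N, sync p.+1 N.
Proof.
move=> dp.
have ex : exists n, y n <= tail x p.+1.
  by have [n /ltW] := term_lt_eventually admy (tail_gt0 admx p.+1); exists n.
case: (ex_minnP ex) => N Np Nmin; exists N.
have yN k : (k < N)%N -> tail x p.+1 < y k.
  by move=> kN; rewrite ltNge; apply/negP => /Nmin; rewrite leqNgt kN.
split=> //; apply/eqP; rewrite eq_le; apply/andP; split.
  rewrite leNgt; apply/negP => pN.
  have EN : E (tail y N) by rewrite /E -Exy; exact: achievement_tail.
  have [|i Ni|//|A [_ Ax xA]] := @subsum_dense _ _ admy (gap p) N (x p).
  - by rewrite subr_gt0.
  (* A point [q] of [E] just below [y i] is a subsum of [y] using only indices after [i], so
     [tail y i.+1] is at least [q]. *)
  - have [|q Eq /andP[qy yq]] := @dominant_gap_dense p (y i) dp.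
      case: admy => -> _ _ /=.
      exact: le_trans (admissible_le admy Ni) Np.
    apply: lt_le_trans yq _; rewrite lerD2r.
    have [A qA] := subsumy Eq; rewrite qA in qy *.
    exact: (subsum_le admy (subsum_lt_term admy qy)).
  - by case: admx => -> _ _ /=; exact: achievement_gap.
  have : x p <= subsum y A.
    by apply: achievement_gap; rewrite /gap in xA;
      [rewrite /E -Exy; apply/achievement_setP; exists A|lra].
  by rewrite leNgt Ax.
have [A tA] := subsumy (achievement_tail x p.+1).
rewrite tA; apply: subsum_le => // k Ak /=; rewrite leqNgt; apply/negP => /yN.
by rewrite tA ltNge (subsum_ge admy Ak).
Qed.

Lemma sync_step n N' : (forall n, x n <> 2 * x n.+1) -> sync n.+1 N' ->
  exists N, [/\ N' = N.+1, y N = x n & sync n N].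
Proof.
move=> x2 [tN yN]; case: N' tN yN => [|N] tN yN.
  have := tail_gt0 admx n.+1; have := fastx n; have := le_tail admx (leq0n n).
  by rewrite -tail0 tN tailS//; lra.
exists N.
have xny : x n <= y N.
  by apply: achievement_gap; [rewrite /E -Exy; exact: achievement_term|exact: yN].
have yxn : y N <= x n.
  (* As a subsum of [y] above [tail y N.+1], [x n] uses an index at most [N], whose term is at least
     [y N]. *)
  have [A xA] := subsumy (achievement_term admx n).
  have [|k kN Ak] := @subsum_gt_tail _ _ admy N.+1 A; first by rewrite tN -xA.
  by rewrite xA; apply: le_trans (subsum_ge admy Ak); exact: admissible_le.
have yx : y N = x n by apply/eqP; rewrite eq_le yxn.
have tNn : tail y N = tail x n by rewrite (tailS admy) (tailS admx) tN yx.
split=> //; split=> // k kN; rewrite ltNge; apply/negP => ykn.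
have yk0 : 0 < y k by case: admy.
case: n => [|n] in tN yN xny yxn yx tNn ykn *.
  (* At index 0, [y k] added to the tail from [N] would exceed the total. *)
  have := le_tail admy (leq0n k); rewrite tailS//.
  have := le_tail admy kN; rewrite tail0 tNn.
  by lra.
have Eyk : E (y k) by rewrite /E -Exy; exact: achievement_term.
apply: (no_translate x2 Eyk (m := n)) => [|e Ee en]; first by rewrite yk0.
(* Indices after [N] suffice for [e] up to [tail x n.+2]; beyond it, remove [x n.+1] and use [y N]
   in its place. Either way [k] stays free, and [y k] can be added. *)
have [A [Ak ->]] : exists A, ~ A k /\ e = subsum y A.
  have yle e' B : e' = subsum y B -> e' <= tail x n.+2 -> B `<=` [set j | (N < j)%N].
    move=> eB e'n j Bj /=; rewrite ltnNge -ltnS; apply/negP => /yN.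
    by rewrite ltNge (le_trans (subsum_ge admy Bj)) -?eB.
  have [en2|ne] := leP e (tail x n.+2).
    have [A eA] := subsumy Ee; exists A; split=> // /(yle _ _ eA en2) /=.
    by rewrite ltnNge ltnW.
  have xe := achievement_gap Ee ne.
  have Ee' : E (e - x n.+1) by apply: achievement_sub => //; rewrite xe.
  have [A eA] := subsumy Ee'.
  have AN : A `<=` [set j | (N < j)%N].
    by apply: yle eA _; rewrite lerBlDl -tailS.
  exists (N |` A); split.
    by move=> [/= kN'|/AN /=]; [rewrite kN' ltnn in kN|rewrite ltnNge ltnW].
  by rewrite subsumU1// -?eA ?yx; [lra|move=> /AN /=; rewrite ltnn].
rewrite /E -Exy; apply/achievement_setP; exists (k |` A).
by rewrite subsumU1.
Qed.

Lemma eq_of_sync n N : (forall n, x n <> 2 * x n.+1) -> sync n N ->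
  N = n /\ forall k, (k < n)%N -> y k = x k.
Proof.
move=> x2; elim: n N => [|n IH] N.
  (* A positive [N] would give a term [y 0] above the total. *)
  case: N => [//|N [_ /(_ 0 erefl)]]; rewrite ltNge -tail0 tailS//.
  by rewrite lerDl ltW// tail_gt0.
move=> /(sync_step x2)[N' [-> yx /IH[N'n yk]]]; rewrite N'n in yx *; split=> // k.
by rewrite ltnS leq_eqVlt => /predU1P[->//|/yk].
Qed.

Lemma achievement_set_inj : (forall n, x n <> 2 * x n.+1) -> y = x.
Proof.
move=> x2; apply/funext => n; have [p [np dp]] := dominant_gap n.
have [N /(eq_of_sync x2)[_]] := sync_dominant dp; exact.
Qed.

End SameSet.
End FastConvergent.

(** * A second representation when some ratio is 2 *)

Section SplitTerm.
Context (R : realType).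
Implicit Types x u : R^nat.

Lemma series_shift u n :
  series u n.+1 = u 0 + series (fun k => u k.+1) n.
Proof. by rewrite /series /= big_nat_recl. Qed.

Lemma is_cvg_series_shift u :
  cvgn (series (fun k => u k.+1)) <-> cvgn (series u).
Proof.
split=> /cvg_ex[l ul]; apply/cvg_ex.
  exists (u 0 + l); rewrite -cvg_shiftS; under eq_fun do rewrite series_shift.
  exact: cvgD (cvg_cst _) ul.
exists (l - u 0).
have -> : series (fun k => u k.+1) = (fun n => series u n.+1 - u 0).
  by apply/funext => n; rewrite series_shift addrC addKr.
by apply: cvgB (cvg_cst _); rewrite cvg_shiftS.
Qed.

Lemma admissible_shift x : admissible x -> admissible (fun k => x k.+1).
Proof.
case=> x0 xd cx; split=> [n|m n mn|]; first exact: x0.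
  exact: xd.
exact/is_cvg_series_shift.
Qed.

Lemma subsum_shift x (A : set nat) : admissible x ->
  subsum (fun k => x k.+1) A = subsum x [set k.+1 | k in A].
Proof.
move=> admx; rewrite /subsum.
set B := [set _ | _ in A]; set u := fun n => \sum_(0 <= k < n | k \in B) x k.
have -> : (fun n => \sum_(0 <= k < n | k \in A) x k.+1) = (fun n => u n.+1).
  apply/funext => n; rewrite /u big_mkcond [RHS]big_mkcond big_nat_recl//=.
  rewrite memNset; last by case.
  rewrite add0r; apply: eq_bigr => k _; congr (if _ then _ else _).
  by apply/idP/idP => /set_mem => [Ak|[j Aj [<-]]]; apply/mem_set => //;
    exists k.
have cu : cvgn u by exact: is_cvg_subsum.
by apply: cvg_lim => //; rewrite cvg_shiftS.
Qed.

(** Case split on whether index 0 is used; it reduces a change of leading terms to propositional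
    reasoning. *)
Lemma achievement_set_cons x e : admissible x ->
  achievement_set x e <->
  achievement_set (fun k => x k.+1) e \/
  achievement_set (fun k => x k.+1) (e - x 0).
Proof.
move=> admx; have S0 (A : set nat) : ~ [set k.+1 | k in A] 0 by case.
split=> [/achievement_setP[A ->]|[|] /achievement_setP[A]]; last 2 first.
- by rewrite subsum_shift// => ->; apply/achievement_setP; eexists.
- rewrite subsum_shift// => eA; apply/achievement_setP.
  by exists (0%N |` [set k.+1 | k in A]); rewrite subsumU1// -eA; lra.
have SA (B : set nat) : ~ B 0 -> B = [set k.+1 | k in [set k | B k.+1]].
  move=> B0; apply/seteqP; split=> [[|k]// Bk|k [j Bj <-]//]; by exists k.
have [A0|A0] := pselect (A 0).
  right; rewrite (subsumD1 admx A0) addrC addKr.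
  rewrite (SA (A `\ 0)); last by case=> _; apply.
  by rewrite -subsum_shift//; apply/achievement_setP; eexists.
by left; rewrite (SA A A0) -subsum_shift//; apply/achievement_setP; eexists.
Qed.

(** Position [n.+2] also receives [x n.+1], through [k.-1]: this is the third copy. *)
Definition split_term x n : R^nat := fun k =>
  if (k < n)%N then x k else if (k <= n.+1)%N then x n.+1 else x k.-1.

Lemma admissible_split_term x n : admissible x -> admissible (split_term x n).
Proof.
move=> admx; have [x0 xd cx] := admx; have le_x := admissible_le admx.
have y0 k : 0 < split_term x n k by rewrite /split_term; do 2?case: ifP.
split=> //.
  apply/nonincreasing_seqP => k; rewrite /split_term.
  by do ![case: ifPn => ?]; apply: le_x; lia.
apply: (@series_le_cvg _ _ (fun k => x k.-1)) => [k|k|k|].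
- exact: ltW.
- exact: ltW.
- by rewrite /split_term; do ![case: ifPn => ?]; apply: le_x; lia.
- exact/is_cvg_series_shift.
Qed.

Lemma achievement_set_split_term x n : admissible x -> x n = 2 * x n.+1 ->
  achievement_set (split_term x n) = achievement_set x.
Proof.
elim: n x => [|n IH] x admx x2; apply/seteqP.
  (* The pair [2 * x 1], [x 1] and three copies of [x 1] both give the multiples of [x 1] by 0, 1,
     2, 3. *)
  have admy := admissible_split_term 0 admx.
  have [sx sy] := (admissible_shift admx, admissible_shift admy).
  have ssy := admissible_shift sy.
  split=> e;
    rewrite (achievement_set_cons _ admx) !(achievement_set_cons _ sx);
    rewrite (achievement_set_cons _ admy) !(achievement_set_cons _ sy);
    rewrite !(achievement_set_cons _ ssy) /split_term /= x2;
    by rewrite mulr_natl mulr2n opprD addrA; tauto.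
have admy := admissible_split_term n.+1 admx.
have yE : (fun k => split_term x n.+1 k.+1) = split_term (fun k => x k.+1) n.
  by apply/funext => -[|k].
have sE := IH _ (admissible_shift admx) x2.
by split=> e; rewrite (achievement_set_cons _ admy) (achievement_set_cons _ admx) yE sE.
Qed.

End SplitTerm.

Theorem theorem4 (R : realType) (E : set R) (x : R^nat)
    (cantorE : central_cantor_set E)
    (minE : E 0 /\ (forall t, E t -> 0 <= t))
    (admx : admissible x) (fastx : fast_convergent x)
    (Ex : E = achievement_set x) :
  uniquely_achievable E <-> (forall n : nat, x n <> 2 * x n.+1).
Proof.
have tx := fast_convergentE fastx.
split=> [[z [admz Ez uz]] n x2|x2]; last first.
  exists x; split=> // -[y [admy yx Eyx]]; apply: yx.
  exact: achievement_set_inj.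
(* The sequence [z] need not be [x] a priori; [x] and its split version are both identified with
   [z], yet differ at [n]. *)
have z_uniq y : admissible y -> achievement_set y = achievement_set x -> y = z.
  move=> admy Eyx; apply: contrapT => yz; apply: uz; exists y.
  by split=> //; rewrite Eyx -Ex.
have := z_uniq _ (admissible_split_term n admx) (achievement_set_split_term admx x2).
rewrite -(z_uniq x)// => /(congr1 (@^~ n)); rewrite /split_term ltnn leqnSn x2.
have : 0 < x n.+1 by case: admx.
lra.
Qed.
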